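(* Let $p>3$ be a prime, and let $g$ be the multiplicative order of $2$ in $\mathbb{Z}_p^*$. Let $n=2^{b}+2^{a}$ where $b>a\ge 0$ are integers and $n\ge 5$. If $a\equiv b\equiv g-1 \bmod g$, then $2^{a}$ is non-essential for $n$ in base $p$. Furthermore, the element $3$ is non-essential for $n$ in both base $2$ and base $p$. Hence $\Phi_{2p}$ is a factor of $Q_{n}(t)$.
   Context: For $S\subseteq[n-1]=\{1,\dots,n-1\}$ let $\beta_n(S)$ be the number of permutations $\pi\in\mathfrak{S}_n$ with descent set $\{i\in[n-1] : \pi_i>\pi_{i+1}\}$ equal to $S$. The $n$th descent set polynomial is $Q_n(t)=\sum_{S\subseteq[n-1]}t^{\beta_n(S)}$. $\Phi_m(t)$ denotes the $m$th cyclotomic polynomial; factors are in $\mathbb{Q}[t]$. For a prime $\ell$ and $1\le k\le n-1$, write $n=\sum_i n_i\ell^i$, $k=\sum_i k_i\ell^i$ with $0\le n_i,k_i<\ell$; $k$ is essential for $n$ in base $\ell$ if $k_i\le n_i$ for all $i$, and non-essential otherwise. *)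

(* Defs.v *)
From HB Require Import structures.
From mathcomp Require Import all_boot all_order all_fingroup all_algebra all_field.

Set Implicit Arguments.
Unset Strict Implicit.
Unset Printing Implicit Defensive.

Import GRing.Theory.

Local Open Scope ring_scope.

(* Positions and values of a permutation are 0-based, so the element i + 1 of
   [n - 1] is represented by i : 'I_n.-1; positions i and i + 1 are named by
   j, k : 'I_n. *)
Definition descent_set (n : nat) (s : 'S_n) : {set 'I_n.-1} :=
  [set i : 'I_n.-1 | [exists j : 'I_n, [exists k : 'I_n,
     [&& j == i :> nat, k == i.+1 :> nat & (s k < s j)%N]]]].

Definition beta (n : nat) (S : {set 'I_n.-1}) : nat :=
  #|[set s : 'S_n | descent_set s == S]|.

Definition descent_poly (n : nat) : {poly rat} :=
  \sum_(S : {set 'I_n.-1}) 'X^(beta S).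

Definition digit (l m i : nat) : nat := ((m %/ l ^ i) %% l)%N.

Definition essential (l n k : nat) : Prop :=
  (0 < k < n)%N /\ forall i : nat, (digit l k i <= digit l n i)%N.

Definition nonessential (l n k : nat) : Prop :=
  (0 < k < n)%N /\ ~ essential l n k.

(* 'Phi_m has integer coefficients in the library; factors are taken over Q. *)
Definition cyclotomic_rat (m : nat) : {poly rat} :=
  map_poly (intr : int -> rat) 'Phi_m.

(* Main.v *)
(* Let gamma be the number of permutations whose descent set agrees with S
   except possibly at k, that is, beta(S) + beta(S') where S' is S with k
   toggled.  Sorting these permutations by the set of values in the first k
   positions gives 'C(n, k) classes of equal size, so a prime dividing
   'C(n, k) divides gamma.  Mod p the last digits of n, 2^a and 3 are 1,
   (p + 1) / 2 and 3, so p divides 'C(n, 3) and 'C(n, 2^a): toggling 3 and 2^a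
   in turn keeps beta(S) mod p.  For 0 < k < n, 'C(n, k) is odd only for
   k = 2^a and k = 2^b, so the parity of beta(S) depends only on the
   intersection of S with {2^a, 2^b}, and it is odd exactly when S contains both
   or neither.  Toggling 3 and 2^a is thus an involution on the sets S that
   shifts beta(S) by p mod 2p, which pairs the terms of Q_n into multiples of
   t^p + 1. *)
Require Import Defs.
From HB Require Import structures.
From mathcomp Require Import all_boot all_order all_fingroup all_algebra all_field.
From mathcomp Require Import zify.

Set Implicit Arguments.
Unset Strict Implicit.
Unset Printing Implicit Defensive.

Import GRing.Theory.

(** * Descents as comparisons of adjacent positions *)

Lemma lo_subproof n (i : 'I_n.-1) : i < n.
Proof. by case: n i => [|n] [i] //=; apply: ltnW. Qed.

Lemma hi_subproof n (i : 'I_n.-1) : i.+1 < n.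
Proof. by case: n i => [|n] []. Qed.

(* [i : 'I_n.-1] stands for the element i + 1 of [n - 1]; [lo i] and [hi i] are the
   0-based positions compared when testing whether it is a descent. *)
Definition lo n (i : 'I_n.-1) : 'I_n := Ordinal (lo_subproof i).
Definition hi n (i : 'I_n.-1) : 'I_n := Ordinal (hi_subproof i).

Lemma mem_descent_set n (s : 'S_n) (i : 'I_n.-1) :
  (i \in descent_set s) = (s (hi i) < s (lo i)).
Proof.
rewrite inE; apply/existsP/idP => [[j /existsP[k /and3P[/eqP ji /eqP ki lt_s]]]|lt_s].
  have <- : j = lo i by apply: val_inj.
  by have <- : k = hi i by apply: val_inj.
by exists (lo i); apply/existsP; exists (hi i); rewrite !eqxx.
Qed.

(** An increasing [s] satisfies k <= s(k) for every k. Both sides have the same sum, so each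
    inequality is an equality. *)
Lemma descent_set_eq0 n (s : 'S_n) : (descent_set s == set0) = (s == 1%g).
Proof.
apply/eqP/eqP => [D0 | ->]; last first.
  by apply/setP=> i; rewrite mem_descent_set !perm1 inE /=; lia.
have s_ge k (lt_k : k < n) : k <= s (Ordinal lt_k).
  elim: k lt_k => // k IHk lt_k.
  have lt_k' : k < n.-1 by lia.
  have := mem_descent_set s (Ordinal lt_k'); rewrite D0 inE => /esym/negbT.
  have -> : lo (Ordinal lt_k') = Ordinal (ltnW lt_k) by apply: val_inj.
  have -> : hi (Ordinal lt_k') = Ordinal lt_k by apply: val_inj.
  rewrite -leqNgt leq_eqVlt => /orP[/eqP/val_inj/perm_inj/(congr1 val)/= |]; first lia.
  exact: leq_ltn_trans.
have le_s (i : 'I_n) : true -> i <= s i ?= iff (i == s i :> nat).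
  by move=> _; split=> //; case: i.
have := (leqif_sum le_s).2.
rewrite [X in _ == X](_ : _ = \sum_(i < n) i) ?eqxx; last by rewrite [RHS](reindex_perm s).
move=> /esym/forallP s_id; apply/permP=> i; rewrite perm1.
by apply/esym/val_inj/eqP/s_id.
Qed.

(** * Permutations with a prescribed set of values in the first positions *)

Definition init n (k : nat) : {set 'I_n} := [set j : 'I_n | j < k].

Lemma card_init n k : k <= n -> #|init n k| = k.
Proof.
move=> le_kn; rewrite -sum1dep_card -(big_ord_widen _ (fun=> 1)) //.
by rewrite sum1_card card_ord.
Qed.

Definition fiber n (S : {set 'I_n.-1}) (i : 'I_n.-1) (A : {set 'I_n}) : {set 'S_n} :=
  [set s : 'S_n | (s @: init n i.+1 == A) && (descent_set s :\ i == S :\ i)].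

(* The relative order of j and j' = j + 1 is never tested, because A separates them. *)
Lemma tperm_adjacent_mono n (A : {set 'I_n}) (j j' x y : 'I_n) :
    j' = j.+1 :> nat -> (j \in A) != (j' \in A) -> (x \in A) = (y \in A) ->
  (tperm j j' x < tperm j j' y) = (x < y).
Proof.
move=> jj' Ajj' Axy.
have lo_ne (z : 'I_n) : z <> j -> z <> j :> nat by move=> ne /val_inj.
have hi_ne (z : 'I_n) : z <> j' -> z <> j' :> nat by move=> ne /val_inj.
case: tpermP Axy => [-> | -> | /lo_ne xj /hi_ne xj'] Axy;
  case: tpermP Axy => [-> | -> | /lo_ne yj /hi_ne yj'] Axy; try lia;
  by rewrite Axy eqxx in Ajj'.
Qed.

(** Composing with the transposition of the values [j] and [j'] is injective. A comparison at k != i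
    involves two positions on the same side of the cut after [i], hence two values both in [A] or
    both outside it, and its outcome is preserved. *)
Lemma leq_fiber_swap n (S : {set 'I_n.-1}) i (A : {set 'I_n}) (j j' : 'I_n) :
    j' = j.+1 :> nat -> (j \in A) != (j' \in A) ->
  #|fiber S i A| <= #|fiber S i (tperm j j' @: A)|.
Proof.
move=> jj' Ajj'; rewrite -(card_imset _ (mulIg (tperm j j'))).
apply/subset_leq_card/subsetP=> _ /imsetP[s + ->].
rewrite !inE => /andP[/eqP sA /eqP <-]; rewrite -sA -imset_comp.
rewrite (eq_imset _ (permM s (tperm j j'))) eqxx.
apply/eqP/setP=> k; rewrite !in_setD1 !mem_descent_set !permM.
case: eqVneq => //= ki; apply: tperm_adjacent_mono jj' Ajj' _.
rewrite -sA !(mem_imset _ _ (@perm_inj _ s)) !inE /=.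
by have := ki; rewrite -val_eqE /=; lia.
Qed.

Lemma card_fiber_swap n (S : {set 'I_n.-1}) i (A : {set 'I_n}) (j j' : 'I_n) :
    j' = j.+1 :> nat -> (j \in A) != (j' \in A) ->
  #|fiber S i (tperm j j' @: A)| = #|fiber S i A|.
Proof.
move=> jj' Ajj'; apply/eqP; rewrite eqn_leq leq_fiber_swap // andbT.
have {2}-> : A = tperm j j' @: (tperm j j' @: A).
  by rewrite -imset_comp (eq_imset _ (tpermK j j')) imset_id.
apply: leq_fiber_swap jj' _.
have mem_tA z : (tperm j j' z \in tperm j j' @: A) = (z \in A).
  exact: (mem_imset _ _ (@perm_inj _ _)).
have := mem_tA j; have := mem_tA j'; rewrite tpermL tpermR => -> ->.
by rewrite eq_sym.
Qed.

(** Otherwise the complement of [A] is closed under successor, so [A] lies below each missing x and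
    #|A| <= x. Hence [A] contains everything below #|A|. *)
Lemma exists_ascent_into n (A : {set 'I_n}) : A != init n #|A| ->
  exists j j' : 'I_n, [/\ j' = j.+1 :> nat, j \notin A & j' \in A].
Proof.
move=> A_ninit.
have le_An : #|A| <= n by rewrite -[n in _ <= n]card_ord max_card.
case: (boolP [exists j : 'I_n, exists j' : 'I_n, [&& j' == j.+1 :> nat, j \notin A & j' \in A]]).
  by case/existsP=> j /existsP[j' /and3P[/eqP ? ? ?]]; exists j, j'.
move=> no_pair; case/negP: A_ninit; rewrite eq_sym eqEcard card_init // leqnn andbT.
apply/subsetP=> x; rewrite inE => lt_xA; apply: contraLR lt_xA => xNA.
have geN k (lt_k : k < n) : x <= k -> Ordinal lt_k \notin A.
  elim: k lt_k => [|k IHk] lt_k.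
    by rewrite leqn0 => /eqP x0; rewrite (_ : Ordinal _ = x) //; apply: val_inj.
  rewrite leq_eqVlt => /orP[/eqP xk | lt_xk].
    by rewrite (_ : Ordinal _ = x) //; apply: val_inj.
  apply: contra no_pair => kA; apply/existsP; exists (Ordinal (ltnW lt_k)).
  by apply/existsP; exists (Ordinal lt_k); rewrite eqxx IHk.
rewrite -leqNgt -[X in _ <= X](card_init (ltnW (ltn_ord x))) subset_leq_card //.
apply/subsetP=> -[k lt_k] kA; rewrite inE ltnNge.
by apply: contraL kA => /geN.
Qed.

(** A swap from [exists_ascent_into] replaces one element of [A] by its predecessor, so the sum of
    the elements drops until [A] is an initial segment. *)
Lemma card_fiber n (S : {set 'I_n.-1}) (i : 'I_n.-1) (A : {set 'I_n}) : #|A| = i.+1 ->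
  #|fiber S i A| = #|fiber S i (init n i.+1)|.
Proof.
have [k] := ubnP (\sum_(x in A) x); elim: k A => // k IHk A ltAk cardA.
have [{1}->|] := eqVneq A (init n #|A|); first by rewrite cardA.
case/exists_ascent_into=> j [j' [jj' jNA j'A]].
have Ajj' : (j \in A) != (j' \in A) by rewrite j'A (negPf jNA).
rewrite -(card_fiber_swap S i jj' Ajj') IHk //; last by rewrite card_imset //; apply: perm_inj.
rewrite ltnS in ltAk; apply: leq_trans ltAk; rewrite big_imset /=; last by move=> ? ? _ _; apply: perm_inj.
rewrite (bigD1 j') // [X in _ < X](bigD1 j') //= tpermR jj' addSn ltnS leq_add2l.
apply: leq_sum => x /andP[xA xj']; rewrite tpermD // 1?eq_sym //.
by apply: contraNneq jNA => <-.
Qed.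

(** * Toggling one element of a descent set *)

Definition toggle (T : finType) (i : T) (S : {set T}) : {set T} :=
  [set j | (j \in S) (+) (j == i)].

Lemma eq_setD1 (T : finType) (i : T) (A B : {set T}) :
  (A :\ i == B :\ i) = (A == B) || (A == toggle i B).
Proof.
apply/eqP/orP => [/setP eqAB | [/eqP -> // | /eqP ->]]; last first.
  by apply/setP=> j; rewrite !inE; case: eqVneq => //= _; rewrite addbF.
have eqABj j : j != i -> (j \in A) = (j \in B).
  by move=> ji; have := eqAB j; rewrite !inE ji.
have [eqi | nei] := eqVneq (i \in A) (i \in B); [left | right].
  by apply/eqP/setP=> j; have [-> | /eqABj] := eqVneq j i.
apply/eqP/setP=> j; rewrite inE; have [-> | /eqABj ->] := eqVneq j i.
  by rewrite addbT -addbT; move: nei; do 2!case: (_ \in _).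
by rewrite addbF.
Qed.

Lemma toggle_neq (T : finType) (i : T) (S : {set T}) : toggle i S != S.
Proof.
apply/eqP=> /setP/(_ i); rewrite inE eqxx addbT.
by case: (_ \in _).
Qed.

Lemma card_eq_toggle (X U : finType) (f : X -> {set U}) i (S : {set U}) :
  #|[set x | f x == S]| + #|[set x | f x == toggle i S]| =
  #|[set x | f x :\ i == S :\ i]|.
Proof.
rewrite -cardsUI [_ :&: _](_ : _ = set0) ?cards0 ?addn0.
  by apply: eq_card => s; rewrite !inE eq_setD1.
apply/setP=> s; rewrite !inE; apply: contraNF (toggle_neq i S).
by case/andP=> /eqP -> /eqP <-.
Qed.

Lemma beta_toggle n (S : {set 'I_n.-1}) (i : 'I_n.-1) :
  beta S + beta (toggle i S) = 'C(n, i.+1) * #|fiber S i (init n i.+1)|.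
Proof.
rewrite card_eq_toggle -sum1_card (partition_big (fun s : 'S_n => s @: init n i.+1)
  (fun A : {set 'I_n} => #|A| == i.+1)) /=; last first.
  by move=> s _; rewrite (card_imset _ (@perm_inj _ s)) card_init // lo_subproof.
rewrite (eq_bigr (fun _ => #|fiber S i (init n i.+1)|)); last first.
  move=> A /eqP cardA; rewrite -(card_fiber S cardA) -sum1_card.
  by apply: eq_bigl => s; rewrite !inE andbC.
rewrite sum_nat_const; congr (_ * _).
by rewrite -cardsE card_draws card_ord.
Qed.

(** The fiber contains only the identity: when the first i + 1 values are the smallest ones, [i]
    cannot be a descent, so no descent remains. *)
Lemma beta_toggle_set0 n (i : 'I_n.-1) :
  @beta n set0 + @beta n (toggle i set0) = 'C(n, i.+1).
Proof.
rewrite beta_toggle -[RHS]muln1; congr (_ * _).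
rewrite (_ : fiber _ _ _ = [set 1%g]) ?cards1 //.
apply/setP=> s; rewrite !inE set0D; apply/andP/eqP => [[/eqP s_init Ds] | ->]; last first.
  have /eqP -> : descent_set (1%g : 'S_n) == set0 by rewrite descent_set_eq0.
  by rewrite set0D (eq_imset _ (@perm1 _)) imset_id.
have mem_s j : (s j \in init n i.+1) = (j \in init n i.+1).
  by rewrite -{1}s_init (mem_imset _ _ (@perm_inj _ s)).
have iND : i \notin descent_set s.
  have := mem_s (lo i); have := mem_s (hi i); rewrite mem_descent_set !in_set /=.
  lia.
apply/eqP; rewrite -descent_set_eq0; apply/eqP/setP=> k.
move/eqP/setP/(_ k): Ds; rewrite in_setD1 !in_set0.
by case: eqVneq => // -> _; apply: negPf.
Qed.

Lemma dvdn_beta_toggle l n (S : {set 'I_n.-1}) (i : 'I_n.-1) :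
  l %| 'C(n, i.+1) -> l %| beta S + @beta n (toggle i S).
Proof. by rewrite beta_toggle; apply: dvdn_mulr. Qed.

(** * Binomial coefficients modulo a prime *)

(** Over F_2, (X + 1)^(2^b + 2^a) = (X^(2^b) + 1)(X^(2^a) + 1); the coefficients of X^k are
    compared. *)
Lemma odd_bin_pow2 a b k : a < b ->
  odd 'C(2 ^ b + 2 ^ a, k) = [|| k == 0, k == 2 ^ a, k == 2 ^ b | k == 2 ^ b + 2 ^ a].
Proof.
move=> lt_ab; have lt_pow : 2 ^ a < 2 ^ b by rewrite ltn_exp2l.
have pow_gt0 : 0 < 2 ^ a by rewrite expn_gt0.
have [lt_nk | le_kn] := ltnP (2 ^ b + 2 ^ a) k; first by rewrite bin_small //=; lia.
have pchar2 : 2%N \in [pchar {poly 'F_2}]%R by rewrite pchar_poly pchar_Fp.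
have pnat_pow m : ([pchar {poly 'F_2}]%R).-nat (2 ^ m) by rewrite pnatX pnatE ?pchar2.
have := congr1 (fun P : {poly 'F_2} => P`_k)%R (exprD1n ('X : {poly 'F_2}) (2 ^ b + 2 ^ a)).
rewrite exprD !exprDn_pchar //.
rewrite mulrDl !mulrDr !expr1n !mul1r !mulr1 -exprD !coefD !coefXn coef1 coef_sum.
rewrite (bigD1 (Ordinal (le_kn : k < (2 ^ b + 2 ^ a).+1))) //= big1 ?addr0; last first.
  move=> i; rewrite -val_eqE /= coefMn coefXn eq_sym => /negPf ->.
  by rewrite mul0rn.
rewrite coefMn coefXn eqxx => coefk.
have odd_natr m : odd m = (m%:R != 0 :> 'F_2)%R.
  by rewrite -(dvdn_pcharf (pchar_Fp (isT : prime 2))) dvdn2 negbK.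
rewrite odd_natr -coefk -!natrD -odd_natr.
lia.
Qed.

(** The prime p divides n - 1, hence k(k - 1)'C(n, k) = n(n - 1)'C(n - 2, k - 2), but neither k nor
    k - 1. *)
Lemma dvdn_bin_mod1 p n k : prime p -> n = 1 %[mod p] -> 1 < k %% p -> p %| 'C(n, k).
Proof.
move=> p_pr n_mod lt1k; have p_gt1 := prime_gt1 p_pr.
have n_gt0 : 0 < n.
  by case: n n_mod => //; rewrite mod0n modn_small.
have p_n1 : p %| n.-1 by rewrite -subn1 -eqn_mod_dvd //; apply/eqP.
have [k' def_k] : exists k', k = k'.+2.
  by exists k.-2; case: k lt1k => [|[|k]] //; rewrite ?mod0n ?modn_small.
have pk : ~~ (p %| k) by rewrite /dvdn; lia.
have pk1 : ~~ (p %| k.-1).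
  apply/negP=> /dvdnP[q def_k1]; have : k = q * p + 1 by lia.
  by move=> def_k'; move: lt1k; rewrite def_k' modnMDl modn_small.
have : p %| k * (k.-1 * 'C(n, k)).
  rewrite def_k /= mulnCA -mul_bin_diag mulnCA -mul_bin_diag.
  exact/dvdn_mull/dvdn_mulr.
by rewrite !Euclid_dvdM // (negPf pk) (negPf pk1).
Qed.

(** * The parity of [beta] *)

Definition block_swap n k (x : 'I_n) : nat :=
  if x < k then x + (n - k) else if n - k <= x then x - (n - k) else x.

Lemma block_swap_subproof n k (le_kn : k.*2 <= n) (x : 'I_n) : block_swap k x < n.
Proof. by rewrite /block_swap; have := ltn_ord x; case: ifP; [lia | case: ifP; lia]. Qed.

(* Swapping the first and last blocks of positions, of equal length i + 1, pairs
   these permutations without fixed points. *)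
Lemma even_card_descent_pal n (i j : 'I_n.-1) : i < j -> i.+1 + j.+1 = n ->
  ~~ odd #|[set s : 'S_n | descent_set s :\ i :\ j == set0]|.
Proof.
move=> lt_ij ijn; set X := [set s | _].
have le_kn : i.+1.*2 <= n by lia.
pose sw x := Ordinal (block_swap_subproof le_kn x).
have swK : involutive sw.
  move=> x; apply: val_inj; rewrite /= {1}/block_swap /= /block_swap.
  by have := ltn_ord x; do ![case: ifP]; lia.
pose t := perm (inv_inj swK).
have tK s : (t * (t * s) = s)%g.
  by apply/permP=> x; rewrite !permM !permE swK.
have XP (s : 'S_n) : reflect (forall m : 'I_n.-1, m != i -> m != j -> s (lo m) <= s (hi m)) (s \in X).
  rewrite inE; apply: (iffP eqP) => [/setP D m mi mj | incr].
    by have := D m; rewrite !in_setD1 in_set0 mi mj mem_descent_set /= => /negbT; rewrite -leqNgt.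
  apply/setP=> m; rewrite !in_setD1 in_set0 mem_descent_set ltnNge.
  have [//|mj] := eqVneq m j; have [//|mi] := eqVneq m i.
  by rewrite incr.
have Xt s : s \in X -> (t * s)%g \in X.
  move=> /XP incr; apply/XP => m; rewrite -!val_eqE /= => mi mj.
  rewrite !permM !permE.
  have lt_m := ltn_ord m; have lt_j := ltn_ord j.
  (* The block boundaries are exactly [i] and [j], so any other adjacent pair of positions m, m + 1
     moves to an adjacent pair m', m' + 1. *)
  have lt_m' : (if m < i then m + j.+1 else if j < m then m - j.+1 else m) < n.-1.
    by case: ifP; [lia | case: ifP; lia].
  pose m' := Ordinal lt_m'.
  have -> : sw (lo m) = lo m'.
    by apply: val_inj; rewrite /= /block_swap /=; do ![case: ifP]; lia.
  have -> : sw (hi m) = hi m'.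
    by apply: val_inj; rewrite /= /block_swap /=; do ![case: ifP]; lia.
  by apply: incr; rewrite -val_eqE /=; do ![case: ifP]; lia.
pose x0 : 'I_n := Ordinal (leq_ltn_trans (leq0n _) (ltn_ord (lo i))).
(* Positions 0 and j + 1 start the two blocks and are exchanged, so exactly one of [s] and [t * s]
   lies in [B]. *)
pose B := [set s : 'S_n | s x0 < s (hi j)].
have swap0 : sw x0 = hi j by apply: val_inj; rewrite /= /block_swap /=; lia.
have swapj : sw (hi j) = x0 by rewrite -swap0 swK.
rewrite -(cardsID B) -[X in X + _](card_preimset _ (mulgI t)).
have -> : mulg t @^-1: (X :&: B) = X :\: B.
  apply/setP=> s; rewrite inE in_setI in_setD andbC; congr (_ && _).
    rewrite !inE !permM !permE swap0 swapj -leqNgt.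
    by rewrite ltn_neqAle val_eqE (inj_eq perm_inj) -val_eqE.
  by apply/idP/idP => [/Xt | /Xt //]; rewrite tK.
by rewrite addnn odd_double.
Qed.

Lemma odd_beta_pow2 n a b (S : {set 'I_n.-1}) (i j : 'I_n.-1) :
    a < b -> n = 2 ^ b + 2 ^ a -> i.+1 = 2 ^ a -> j.+1 = 2 ^ b ->
  odd (beta S) = ((i \in S) == (j \in S)).
Proof.
move=> lt_ab def_n def_i def_j; have lt_pow : 2 ^ a < 2 ^ b by rewrite ltn_exp2l.
have oddC k : odd 'C(n, k) = [|| k == 0, k == 2 ^ a, k == 2 ^ b | k == 2 ^ b + 2 ^ a].
  by rewrite def_n odd_bin_pow2.
have lt_ij : i < j by lia.
have ji : j != i by rewrite -val_eqE /=; lia.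
have odd0 : odd (@beta n set0).
  rewrite /beta (_ : [set s | _] = [set 1%g]) ?cards1 //.
  by apply/setP=> s; rewrite !inE descent_set_eq0.
have oddi : ~~ odd (@beta n (toggle i set0)).
  have := congr1 odd (beta_toggle_set0 i).
  by rewrite oddD odd0 oddC def_i eqxx orbT; case: odd.
have oddj : ~~ odd (@beta n (toggle j set0)).
  have := congr1 odd (beta_toggle_set0 j).
  by rewrite oddD odd0 oddC def_j eqxx !orbT; case: odd.
have oddij : odd (@beta n (toggle i (toggle j set0))).
  (* The four subsets of {i, j} together account for all permutations with descents inside {i, j},
     an even number by [even_card_descent_pal]. *)
  have : ~~ odd (@beta n set0 + @beta n (toggle i set0) +
                 (@beta n (toggle j set0) + @beta n (toggle i (toggle j set0)))).
    rewrite /beta !card_eq_toggle.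
    have -> : toggle j set0 :\ i = toggle j (set0 :\ i).
      by apply/setP=> k; rewrite !inE andbF; case: eqVneq => //= ->; rewrite eq_sym (negPf ji).
    by rewrite card_eq_toggle !set0D even_card_descent_pal //; lia.
  by rewrite !oddD odd0 (negPf oddi) (negPf oddj); case: odd.
(* Elements other than [i] and [j] are removed one at a time, down to the four base cases above. *)
have [c] := ubnP #|S|; elim: c S => // c IHc S ltSc.
have [k /and3P[kS ki kj] | noS] := pickP (fun k => [&& k \in S, k != i & k != j]).
  have memk l : l != k -> (l \in toggle k S) = (l \in S).
    by rewrite inE => /negPf ->; rewrite addbF.
  rewrite -(memk i) 1?eq_sym // -(memk j) 1?eq_sym // -IHc; last first.
    rewrite ltnS in ltSc; apply: leq_trans ltSc; apply: proper_card; apply/properP; split.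
      by apply/subsetP=> l; rewrite inE; case: eqVneq => [->|_]; rewrite ?addbF.
    by exists k => //; rewrite inE eqxx kS.
  have: 2 %| beta S + @beta n (toggle k S).
    apply: dvdn_beta_toggle; rewrite dvdn2 oddC.
    have := ltn_ord k; move: ki kj; rewrite -!val_eqE /=; lia.
  by rewrite dvdn2 oddD; do 2!case: odd.
have Sij l : (l \in S) = (l == i) && (i \in S) || (l == j) && (j \in S).
  have := noS l; case: (eqVneq l i) => [-> _|]; first by rewrite (eq_sym i) (negPf ji) orbF.
  by case: (eqVneq l j) => [-> //|]; rewrite !andbT.
have eqS (S' : {set 'I_n.-1}) :
    (forall l, (l \in S') = (l == i) && (i \in S) || (l == j) && (j \in S)) -> beta S = beta S'.
  by move=> memS'; congr beta; apply/setP=> l; rewrite memS'.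
case: (i \in S) (j \in S) {Sij noS} eqS => [] [] eqS.
- rewrite (eqS (toggle i (toggle j set0))) ?oddij // => l.
  by rewrite !inE; case: (eqVneq l i) => [->|]; rewrite ?(eq_sym i) ?(negPf ji) //= !addbF andbT.
- rewrite (eqS (toggle i set0)) ?(negPf oddi) // => l.
  by rewrite !inE andbT andbF orbF.
- rewrite (eqS (toggle j set0)) ?(negPf oddj) // => l.
  by rewrite !inE andbT andbF.
- rewrite (eqS set0) ?odd0 // => l.
  by rewrite !inE !andbF.
Qed.

(** * Polynomial divisibility *)

(** In X^(2m) - 1 = (X^m - 1)(X^m + 1), the factors 'Phi_d with d dividing m make up X^m - 1; the
    others, among them that of 2m, give X^m + 1. *)
Lemma Cyclotomic_double_dvd m : 0 < m ->
  exists q : {poly int}, ('X^m + 1 = 'Phi_(2 * m)%N * q)%R.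
Proof.
move=> m_gt0; pose P := (\prod_(d <- divisors (2 * m)%N | ~~ (d %| m)%N) 'Phi_d)%R.
have -> : ('X^m + 1 = P)%R.
  have Xm1_neq0 : ('X^m - 1 != 0 :> {poly int})%R.
    by rewrite -lead_coef_eq0 lead_coefXnsubC.
  apply: (mulfI Xm1_neq0).
  transitivity ('X^(2 * m)%N - 1 : {poly int})%R.
    by rewrite mulrDr mulr1 mulrBl mul1r -exprD mul2n addnn addrA subrK.
  rewrite -prod_Cyclotomic ?muln_gt0 // (bigID (fun d => d %| m)) /=; congr (_ * _)%R.
  rewrite -prod_Cyclotomic // -big_filter; apply: perm_big.
  apply: uniq_perm; rewrite ?filter_uniq ?divisors_uniq // => d.
  rewrite mem_filter -!dvdn_divisors ?muln_gt0 //.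
  by case: (boolP (d %| m)) => //= d_m; rewrite dvdn_mull.
have m2_ndvd : ~~ (2 * m %| m) by apply/negP=> /dvdn_leq; lia.
rewrite /P (big_rem (2 * m)) ?m2_ndvd /=; last first.
  by rewrite -dvdn_divisors ?muln_gt0 // dvdnn.
by eexists.
Qed.

(** Modulo X^p + 1 one has X^p = -1, and the exponents differ by an odd multiple of p. *)
Lemma dvdp_XnD1_XnDXm (R : idomainType) p x y :
    x = y %[mod p] -> odd x != odd y -> odd p ->
  (('X^p + 1 : {poly R}) %| 'X^x + 'X^y)%R.
Proof.
wlog le_xy : x y / x <= y => [hwlog|] xy_mod odd_xy odd_p.
  have [/hwlog|/ltnW/hwlog] := leqP x y; first exact.
  by rewrite [X in (_ %| X)%R]addrC; apply=> //; rewrite eq_sym.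
have /dvdnP[q def_q] : p %| y - x by rewrite -eqn_mod_dvd //; apply/eqP.
have def_y : y = x + p * q by rewrite mulnC -def_q subnKC.
have odd_q : odd q.
  by move: odd_xy; rewrite def_y oddD oddM odd_p; case: odd; case: odd.
have -> : ('X^x + 'X^y = 'X^x * (1 + 'X^p ^+ q) :> {poly R})%R.
  by rewrite def_y exprD exprM mulrDr mulr1.
apply: dvdp_mull.
have -> : (1 + 'X^p ^+ q = - ((- 'X^p) ^+ q - 1) :> {poly R})%R.
  by rewrite exprNn -signr_odd odd_q mulN1r opprD !opprK addrC.
rewrite dvdpNr subrX1 dvdp_mulr // -dvdpNr opprD !opprK dvdpp //.
Qed.

(** Doubling the sum avoids choosing one index per orbit; 2 is invertible in Q. *)
Lemma dvdp_sum_involutive (I : finType) (h : I -> I) (F : I -> {poly rat}) (d : {poly rat}) :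
    involutive h -> (forall i, d %| F i + F (h i))%R -> (d %| \sum_i F i)%R.
Proof.
move=> hK dF.
have: (d %| 2%:R *: \sum_i F i)%R.
  rewrite scaler_nat mulr2n {2}(reindex_inj (inv_inj hK)) -big_split /=.
  by apply: (big_ind (fun P => d %| P)%R) => [|? ?|//]; [apply: dvdp0 | apply: dvdp_add].
by rewrite dvdpZr.
Qed.

Lemma cyclotomic_dvdp_XnD1 m : 0 < m ->
  (cyclotomic_rat (2 * m) %| ('X^m + 1 : {poly rat}))%R.
Proof.
case/Cyclotomic_double_dvd=> q def_q.
have -> : ('X^m + 1 = map_poly (intr : int -> rat) ('X^m + 1))%R.
  by rewrite rmorphD rmorph1 /= map_polyXn.
by rewrite def_q rmorphM dvdp_mulr.
Qed.

(** * Residues and digits of n, and the conclusion *)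

Lemma pow2_order_mod p (u : {unit 'F_p}) c :
    prime p -> (val u = 2%:R :> 'F_p)%R -> c = #[u]%g - 1 %[mod #[u]%g] ->
  2 ^ c.+1 = 1 %[mod p].
Proof.
move=> p_prime u_two c_mod; have p_gt1 := prime_gt1 p_prime.
have /dvdnP[q def_c] : #[u]%g %| c.+1.
  by rewrite -[c.+1]addn1 /dvdn -modnDml c_mod modnDml subnK ?order_gt0 // modnn.
have : (u ^+ c.+1 = 1)%g by rewrite def_c mulnC expgM expg_order expg1n.
move/(congr1 val); rewrite FinRing.val_unitX u_two FinRing.val_unit1 -natrX.
rewrite -[RHS]/(1%:R)%R => /(congr1 val).
by rewrite /= val_Fp_nat // Fp_cast.
Qed.

Lemma nonessential_mod1 p n k :
  n %% p = 1 -> 0 < k < n -> 1 < k %% p -> nonessential p n k.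
Proof.
move=> n_modp k_lt gt1; split=> // -[_ /(_ 0)].
by rewrite /digit expn0 !divn1 n_modp leqNgt gt1.
Qed.

(** Both binary digits of 3 are 1, while the last two digits of 2^b + 2^a are both 1 only for a = 0,
    b = 1, where the sum is 3. *)
Lemma nonessential_base2_3 a b :
  a < b -> 5 <= 2 ^ b + 2 ^ a -> nonessential 2 (2 ^ b + 2 ^ a) 3.
Proof.
move=> lt_ab n_ge5; split; first by rewrite (leq_trans _ n_ge5).
case=> _ ess; have := ess 1; have := ess 0; rewrite /digit expn0 expn1 !divn1.
case: a b lt_ab n_ge5 {ess} => [|a'] [|[|b']] // _ _; rewrite !expnS; lia.
Qed.

Lemma cyclotomic_dvdp_descent_poly p n a b :
    prime p -> odd p -> a < b -> n = 2 ^ b + 2 ^ a -> 5 <= n ->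
    n = 1 %[mod p] -> 1 < 2 ^ a %% p -> 1 < 3 %% p ->
  (cyclotomic_rat (2 * p)%N %| descent_poly n)%R.
Proof.
move=> p_prime p_odd lt_ab n_def n_ge5 n_mod1 pow_mod three_mod.
have lt_pow : 2 ^ a < 2 ^ b by rewrite ltn_exp2l.
have pow_gt0 : 0 < 2 ^ a by rewrite expn_gt0.
have [lt_i lt_j lt_k] : [/\ (2 ^ a).-1 < n.-1, (2 ^ b).-1 < n.-1 & 2 < n.-1].
  by clear - lt_pow pow_gt0 n_def n_ge5; split; lia.
(* With the shift by one, [i], [j], [k] stand for 2^a, 2^b and 3. As 3 is not a power of 2, toggling
   [k] keeps the parity of [beta] and toggling [i] flips it. *)
pose i := Ordinal lt_i; pose j := Ordinal lt_j; pose k := Ordinal lt_k.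
have pow_neq3 c : 2 ^ c != 3.
  case: c => // c; apply/eqP=> /(congr1 odd).
  by rewrite expnS oddM.
have i_S : i.+1 = 2 ^ a by rewrite /= prednK.
have j_S : j.+1 = 2 ^ b by rewrite /= prednK ?expn_gt0.
have ki : k != i by rewrite -val_eqE -eqSS i_S eq_sym pow_neq3.
have kj : k != j by rewrite -val_eqE -eqSS j_S eq_sym pow_neq3.
have ji : j != i by rewrite -val_eqE -eqSS i_S j_S gtn_eqF.
apply: dvdp_trans (cyclotomic_dvdp_XnD1 (prime_gt0 p_prime)) _.
apply: (@dvdp_sum_involutive _ (toggle i \o toggle k)) => [S | S].
  apply/setP=> l; rewrite !inE.
  by case: (l \in S); do ![case: eqP].
apply: dvdp_XnD1_XnDXm => //=; last first.
  rewrite !(odd_beta_pow2 _ lt_ab n_def i_S j_S) !inE eqxx.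
  rewrite (negPf ji) (eq_sym i) (negPf ki) (eq_sym j) (negPf kj).
  by case: (i \in S); case: (j \in S).
have bk : p %| beta S + beta (toggle k S).
  by apply/dvdn_beta_toggle/dvdn_bin_mod1.
have bi : p %| beta (toggle k S) + beta (toggle i (toggle k S)).
  by apply/dvdn_beta_toggle/dvdn_bin_mod1; rewrite // i_S.
apply/eqP; rewrite -(eqn_modDr (beta (toggle k S))).
by rewrite (eqP bk) addnC (eqP bi).
Qed.

Local Open Scope ring_scope.

Theorem theorem5p10 (p : nat) (p_prime : prime p) (p_gt3 : (3 < p)%N)
  (u : {unit 'F_p}) (u_two : val u = 2%:R :> 'F_p)
  (g : nat) (g_def : g = #[u]%g)
  (n a b : nat) (a_lt_b : (a < b)%N)
  (n_def : n = (2 ^ b + 2 ^ a)%N) (n_ge5 : (5 <= n)%N)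
  (a_mod : a = b %[mod g]) (b_mod : b = (g - 1)%N %[mod g]) :
  nonessential p n (2 ^ a)%N /\
  (nonessential 2 n 3 /\ nonessential p n 3) /\
  cyclotomic_rat (2 * p)%N %| descent_poly n.
Proof.
have p_gt1 := prime_gt1 p_prime.
have p_odd : odd p by have [p2|//] := even_prime p_prime; rewrite p2 in p_gt3.
have b_mod1 : (2 ^ b.+1 = 1 %[mod p])%N.
  by apply: (pow2_order_mod p_prime u_two); rewrite -g_def.
have a_mod1 : (2 ^ a.+1 = 1 %[mod p])%N.
  by apply: (pow2_order_mod p_prime u_two); rewrite -g_def a_mod.
(* Here 2n = 2^(b+1) + 2^(a+1) is 2 mod p, and 2 can be cancelled because p is odd. *)
have n_mod1 : (n = 1 %[mod p])%N.
  have n_gt0 : (0 < n)%N := leq_trans (isT : 0 < 5)%N n_ge5.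
  have coprime_p2 : coprime p 2 by rewrite coprimen2.
  apply/eqP; rewrite eqn_mod_dvd // -(Gauss_dvdr _ coprime_p2) mulnBr.
  rewrite -eqn_mod_dvd ?leq_pmul2l //.
  by rewrite n_def mulnDr -!expnS -modnDm a_mod1 b_mod1 modnDm.
have n_modp : (n %% p = 1)%N by rewrite n_mod1 modn_small.
(* The residue of 2^a is an inverse of 2, so it is neither 0 nor 1. *)
have pow_mod : (1 < 2 ^ a %% p)%N.
  move: a_mod1; rewrite expnS -modnMmr; case: (2 ^ a %% p)%N => [|[|//]].
    by rewrite muln0 mod0n modn_small.
  by rewrite muln1 !modn_small // ltnW.
have three_mod : (1 < 3 %% p)%N by rewrite modn_small.
split; [|split; [split|]].
- apply: nonessential_mod1 => //.
  by rewrite n_def expn_gt0 -[(2 ^ a).+1%N]add1n leq_add2r expn_gt0.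
- by rewrite n_def in n_ge5 *; apply: nonessential_base2_3.
- by apply: nonessential_mod1; rewrite // (leq_trans _ n_ge5).
- exact: cyclotomic_dvdp_descent_poly p_prime p_odd a_lt_b n_def n_ge5 n_mod1 pow_mod three_mod.
Qed.
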